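(* Let $V$ be an $\ell$-Volterra quadratic stochastic operator on $S^{m-1}$ with associated coefficients $a_{ki}$. Suppose there exist $k_0\in\{1,\dots,\ell\}$ and $\delta>0$ such that $a_{k_0i}\le-\delta$ for every $i\in E$. Then for every $x^0\in S^{m-1}$ with $x^0\notin\mathrm{Fix}(V)$, $$\omega(x^0)\subset\Big\{x\in S^{m-1}:\ \prod_{i=1}^{\ell}x_i=0\Big\}.$$
   Context: Let $E=\{1,\dots,m\}$ and $S^{m-1}=\{x\in\mathbb{R}^m: x_i\ge 0,\ \sum_{i=1}^m x_i=1\}$. A quadratic stochastic operator is a map $V:S^{m-1}\to S^{m-1}$, $V(x)_k=\sum_{i,j=1}^m P_{ij,k}x_ix_j$, where $P_{ij,k}\ge 0$, $P_{ij,k}=P_{ji,k}$, $\sum_{k=1}^m P_{ij,k}=1$ for all $i,j,k\in E$. For a fixed $\ell\in E$, $V$ is called $\ell$-Volterra if (i) $P_{ij,k}=0$ whenever $k\in\{1,\dots,\ell\}$, $i,j\in E$ and $k\notin\{i,j\}$; and (ii) for every $k\in\{\ell+1,\dots,m\}$ there is at least one pair $(i,j)$ with $i\ne k$, $j\ne k$ and $P_{ij,k}>0$. Its associated coefficients are $a_{ki}=2P_{ik,k}-1$ for $k\ne i$ and $a_{kk}=P_{kk,k}-1$ ($k,i\in E$). For $k\le\ell$ one then has $V(x)_k=x_k(1+\sum_{i=1}^m a_{ki}x_i)$. The trajectory of $x^0$ is $x^{(0)}=x^0$, $x^{(n+1)}=V(x^{(n)})$; $\omega(x^0)$ is the set of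 limit points of $\{x^{(n)}\}$ (limits of convergent subsequences), and $\mathrm{Fix}(V)=\{x\in S^{m-1}:V(x)=x\}$. *)

(* Defs.v *)
(* Indices are 0-based: E = {1, ..., m} is 'I_m,
   and "k in {1, ..., l}" is (k < l)%N for k : 'I_m. *)
From HB Require Import structures.
From mathcomp Require Import all_boot all_order all_algebra.
From mathcomp Require Import all_classical all_reals all_analysis.
Set Implicit Arguments.
Unset Strict Implicit.
Unset Printing Implicit Defensive.
Import Order.TTheory GRing.Theory Num.Theory.
Import numFieldNormedType.Exports.
Local Open Scope classical_set_scope.
Local Open Scope ring_scope.

Definition simplex (R : realType) (m : nat) : set 'rV[R]_m :=
  [set x | (forall i, 0 <= x ord0 i) /\ \sum_(i < m) x ord0 i = 1].
Arguments simplex : clear implicits.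

(* [P i j k] is the coefficient P_{ij,k}. *)
Record is_heredity (R : realType) (m : nat)
    (P : 'I_m -> 'I_m -> 'I_m -> R) : Prop := IsHeredity {
  heredity_ge0 : forall i j k, 0 <= P i j k ;
  heredity_sym : forall i j k, P i j k = P j i k ;
  heredity_sum1 : forall i j, \sum_(k < m) P i j k = 1 }.

(* The polynomial formula is used on all of R^m; [qso_simplex] shows that it
   restricts to a self-map of the simplex. *)
Definition qso (R : realType) (m : nat) (P : 'I_m -> 'I_m -> 'I_m -> R)
    (x : 'rV[R]_m) : 'rV[R]_m :=
  \row_(k < m) \sum_(i < m) \sum_(j < m) P i j k * x ord0 i * x ord0 j.

Lemma qso_simplex (R : realType) (m : nat) (P : 'I_m -> 'I_m -> 'I_m -> R)
    (x : 'rV[R]_m) :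
  is_heredity P -> simplex R m x -> simplex R m (qso P x).
Proof.
move=> [P0 _ P1] [x0 x1]; split=> [k|].
  rewrite mxE; apply: sumr_ge0 => i _; apply: sumr_ge0 => j _.
  by rewrite !mulr_ge0.
under eq_bigr do rewrite mxE.
rewrite exchange_big /= -[RHS]x1; apply: eq_bigr => i _.
rewrite exchange_big /= -[RHS]mulr1 -x1 mulr_sumr; apply: eq_bigr => j _.
by rewrite -!mulr_suml P1 mul1r.
Qed.

Record is_volterra (R : realType) (m l : nat)
    (P : 'I_m -> 'I_m -> 'I_m -> R) : Prop := IsVolterra {
  volterra_eq0 : forall i j k : 'I_m,
    (k < l)%N -> k != i -> k != j -> P i j k = 0 ;
  volterra_gt0 : forall k : 'I_m, (l <= k)%N ->
    exists i j : 'I_m, [/\ i != k, j != k & 0 < P i j k] }.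

Definition volterra_coef (R : realType) (m : nat)
    (P : 'I_m -> 'I_m -> 'I_m -> R) (k i : 'I_m) : R :=
  if k == i then P k k k - 1 else 2 * P i k k - 1.

Definition Fix (R : realType) (m : nat) (V : 'rV[R]_m -> 'rV[R]_m) :
    set 'rV[R]_m :=
  [set x | simplex R m x /\ V x = x].

Definition trajectory (R : realType) (m : nat) (V : 'rV[R]_m -> 'rV[R]_m)
    (x0 : 'rV[R]_m) (n : nat) : 'rV[R]_m :=
  iter n V x0.

(* [increasing_seq] is strict monotonicity. *)
Definition omega_limit (R : realType) (m : nat) (V : 'rV[R]_m -> 'rV[R]_m)
    (x0 : 'rV[R]_m) : set 'rV[R]_m :=
  [set y | exists phi : nat -> nat, increasing_seq phi /\
     (fun n => trajectory V x0 (phi n)) @ \oo --> y].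

(* Main.v *)
Require Import Defs.
From HB Require Import structures.
From mathcomp Require Import all_boot all_order all_algebra.
From mathcomp Require Import all_classical all_reals all_analysis.
From mathcomp Require Import ring.
Set Implicit Arguments.
Unset Strict Implicit.
Unset Printing Implicit Defensive.
Import Order.TTheory GRing.Theory Num.Theory.
Import numFieldNormedType.Exports.
Local Open Scope classical_set_scope.
Local Open Scope ring_scope.

(** In a coordinate [k] below [l], an [l]-Volterra operator only multiplies:
    [V(x)_k = x_k * (1 + \sum_i a_ki x_i)] ([qso_volterraE]).  On the simplex
    the weights [x_i] sum to 1, so when every [a_ki] is at most [- delta] the
    factor is at most [1 - delta], and the coordinate [k0] of a trajectory
    decays at least geometrically ([trajectory_coord_le]).  The ratio
    satisfies [0 <= 1 - delta < 1], the lower bound because [a_kk >= -1], so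
    the coordinate tends to 0.  Every limit point therefore has a zero [k0]-th
    coordinate, which annihilates the product; it stays in the simplex because
    the simplex is closed ([simplex_cvg]). *)

Section QuadraticStochasticOperator.
Variables (R : realType) (m l : nat) (P : 'I_m -> 'I_m -> 'I_m -> R).
Hypothesis hP : is_heredity P.

Lemma trajectory_simplex (x : 'rV[R]_m) n :
  simplex R m x -> simplex R m (trajectory (qso P) x n).
Proof. by move=> sx; elim: n => //= n; exact: qso_simplex. Qed.

(** Only the pairs [(i, j)] with [k] in [{i, j}] contribute to coordinate [k];
    symmetry of [P] merges [(i, k)] with [(k, i)], which is the factor 2 in
    [volterra_coef], and the [-1] there is absorbed by [\sum_i x_i = 1]. *)
Lemma qso_volterraE (x : 'rV[R]_m) (k : 'I_m) :
  is_volterra l P -> simplex R m x -> (k < l)%N ->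
  qso P x ord0 k = x ord0 k * (1 + \sum_i volterra_coef P k i * x ord0 i).
Proof.
move=> hV [_ x1] kl.
(* Writing 1 as [\sum_i x_i] makes both sides sums over [i], which are then
   compared termwise, the diagonal term [i = k] apart. *)
rewrite mxE -x1 -big_split /= mulr_sumr.
rewrite (bigD1 k)//= (bigD1 k)//= [RHS](bigD1 k)//= -addrA; congr (_ + _).
  by rewrite /volterra_coef eqxx; ring.
rewrite -big_split /=; apply: eq_bigr => i ik.
rewrite (bigD1 k)//= big1 => [|j jk].
  rewrite /volterra_coef eq_sym (negbTE ik) (heredity_sym hP k i k).
  by ring.
by rewrite (volterra_eq0 hV)// 1?eq_sym ?mul0r.
Qed.

Lemma qso_coord_le (x : 'rV[R]_m) (k : 'I_m) (delta : R) :
  is_volterra l P -> simplex R m x -> (k < l)%N ->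
  (forall i, volterra_coef P k i <= - delta) ->
  qso P x ord0 k <= (1 - delta) * x ord0 k.
Proof.
move=> hV sx kl ha; rewrite (qso_volterraE hV)// mulrC.
have [x0 x1] := sx; rewrite ler_wpM2r// lerD2l.
rewrite -[leRHS]mulr1 -x1 mulr_sumr; apply: ler_sum => i _.
exact: ler_wpM2r.
Qed.

Lemma volterra_coef_ge (k : 'I_m) : -1 <= volterra_coef P k k.
Proof. by rewrite /volterra_coef eqxx lerDr (heredity_ge0 hP). Qed.

Lemma trajectory_coord_le (x : 'rV[R]_m) (k : 'I_m) (delta : R) n :
  is_volterra l P -> simplex R m x -> (k < l)%N ->
  (forall i, volterra_coef P k i <= - delta) ->
  trajectory (qso P) x n ord0 k <= (1 - delta) ^+ n * x ord0 k.
Proof.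
move=> hV sx kl ha.
have d1 : 0 <= 1 - delta.
  by have := le_trans (volterra_coef_ge k) (ha k); rewrite lerN2 subr_ge0.
elim: n => [|n IH]; first by rewrite expr0 mul1r.
rewrite exprS -mulrA; apply: le_trans (ler_wpM2l d1 IH).
exact/qso_coord_le/ha/kl/(trajectory_simplex n sx).
Qed.

Lemma trajectory_coord_cvg0 (x : 'rV[R]_m) (k : 'I_m) (delta : R) :
  is_volterra l P -> simplex R m x -> (k < l)%N -> 0 < delta ->
  (forall i, volterra_coef P k i <= - delta) ->
  trajectory (qso P) x n ord0 k @[n --> \oo] --> (0 : R).
Proof.
move=> hV sx kl d0 ha.
have d1 : delta <= 1.
  by have := le_trans (volterra_coef_ge k) (ha k); rewrite lerN2.
apply: (@squeeze_cvgr _ _ _ _ (cst 0) (geometric (x ord0 k) (1 - delta))).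
- apply: nearW => n; have [-> _] := trajectory_simplex n sx.
  by rewrite /= mulrC; exact: trajectory_coord_le.
- exact: cvg_cst.
- by apply: cvg_geometric; rewrite ger0_norm ?subr_ge0// gtrBl.
Qed.

End QuadraticStochasticOperator.

Lemma cvg_row_coord (R : realType) (m : nat) (u : nat -> 'rV[R]_m)
    (y : 'rV[R]_m) (i : 'I_m) :
  u @ \oo --> y -> u n ord0 i @[n --> \oo] --> y ord0 i.
Proof.
by move=> uy; exact: (continuous_cvg _ (@coord_continuous R 1 m ord0 i y)).
Qed.

Lemma simplex_cvg (R : realType) (m : nat) (u : nat -> 'rV[R]_m)
    (y : 'rV[R]_m) :
  (forall n, simplex R m (u n)) -> u @ \oo --> y -> simplex R m y.
Proof.
move=> su uy; split=> [i|].
  have ui := cvg_row_coord (i := i) uy.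
  rewrite -(cvg_lim (@Rhausdorff R) ui); apply: limr_ge.
    by apply/cvg_ex; exists (y ord0 i).
  by apply: nearW => n; have [] := su n.
have sumu : \sum_i u n ord0 i @[n --> \oo] --> \sum_i y ord0 i.
  apply: cvg_big => [|i _]; first exact: add_continuous.
  exact: cvg_row_coord.
rewrite -(cvg_lim (@Rhausdorff R) sumu).
under eq_fun do rewrite (su _).2.
exact: lim_cst.
Qed.

Lemma increasing_seq_cvgny (phi : nat -> nat) :
  increasing_seq phi -> phi @ \oo --> \oo.
Proof.
move=> /increasing_seqP phi_incr; apply/cvgnyPge => A.
have phi_ge n : (n <= phi n)%N.
  by elim: n => // n; rewrite -ltnS => /leq_trans; apply; exact: phi_incr.
by near=> n; apply: leq_trans (phi_ge n); near: n; exact: nbhs_infty_ge.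
Unshelve. all: by end_near. Qed.

Theorem theorem5 (R : realType) (m l : nat) (P : 'I_m -> 'I_m -> 'I_m -> R)
    (hl : (1 <= l <= m)%N)
    (hP : is_heredity P)
    (hV : is_volterra l P)
    (hk : exists (k0 : 'I_m) (delta : R),
       [/\ (k0 < l)%N, 0 < delta & forall i, volterra_coef P k0 i <= - delta])
    (x0 : 'rV[R]_m) (hx0 : simplex R m x0) (hfix : ~ Fix (qso P) x0) :
  omega_limit (qso P) x0 `<=`
    [set x | simplex R m x /\ \prod_(i < m | (i < l)%N) x ord0 i = 0].
Proof.
move=> y [phi [phi_incr phi_y]]; case: hk => k0 [delta [k0l d0 ha]].
have tr0 := trajectory_coord_cvg0 hP hV hx0 k0l d0 ha.
have yk0 : y ord0 k0 = 0.
  apply: (cvg_unique _ (cvg_row_coord (i := k0) phi_y)) => //.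
  exact: cvg_comp (increasing_seq_cvgny phi_incr) tr0.
split; first by apply: simplex_cvg phi_y => n; exact: trajectory_simplex.
by rewrite (bigD1 k0)//= yk0 mul0r.
Qed.
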